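(* Assume that the rival model is linear, that is, $\eta_2(x,\theta_{(2)})=\theta_{(2)}^Tf(x)$ with $\theta_{(2)}\in\Theta_{(2)}=\mathbb{R}^{m_2}$, where $f=(f_1,\ldots,f_{m_2})^T$ is a vector of continuous real-valued functions on $\mathcal{X}$. Then there exists a $T$-optimal design $\xi^*$ (for the fixed function $\eta$ against $\eta_2$) with $m_2+1$ support points.
   Context: $\mathcal{X}$ is the design space, in which the explanatory variable $x$ varies. A design is a probability measure on $\mathcal{X}$ with finite support. $\eta$ is a fixed continuous real-valued function on $\mathcal{X}$ (the first model $\eta(x)=\eta_1(x,\theta_{(1)})$ with the parameter $\theta_{(1)}\in\Theta_{(1)}\subset\mathbb{R}^{m_1}$ fixed; it need not be linear, and the two models need not be nested). For a design $\xi$, $$\Delta(\xi)=\inf_{\theta_{(2)}\in\mathbb{R}^{m_2}}\int_{\mathcal{X}}(\eta(x)-\theta_{(2)}^Tf(x))^2\,d\xi(x),$$ and a design is $T$-optimal if it maximizes $\Delta(\xi)$ over all designs. Standing assumptions: the regression functions $\eta_1$ and $\eta_2$ are continuous in both arguments and differentiable with respect to the parameter, the infimum defining $\Delta(\xi)$ is attained at some $\theta_{(2)}^*\in\mathbb{R}^{m_2}$, and a $T$-optimal design exists.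
   Formalization: ''With m_2+1 support points'' is proved as ''with at most m_2+1 support points''; exactly m_2+1 can fail, e.g. X=[0,1], m_2=1, f(x)=x, eta=1, where the unique T-optimal design is the point mass at 0. *)

(* Defs.v *)
From mathcomp Require Import all_boot all_order all_algebra.
From mathcomp Require Import all_classical all_reals all_analysis.

Set Implicit Arguments.
Unset Strict Implicit.
Unset Printing Implicit Defensive.

Import Order.TTheory GRing.Theory Num.Theory.
Import numFieldNormedType.Exports.

Local Open Scope classical_set_scope.
Local Open Scope ring_scope.

(* A probability measure with finite support is a convex combination of Dirac
   masses, hence it is defined on every subset of X (and determined by its
   restriction to any sigma-algebra containing the singletons).  The design
   space therefore carries its full power set as sigma-algebra; the topology of
   X only serves to speak of continuous functions. *)
Definition design_space (X : ptopologicalType) :=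
  g_sigma_algebraType (@discrete_measurable X).

Section designs.
Context (R : realType) (X : ptopologicalType).
Implicit Types xi zeta : probability (design_space X) R.

Definition support_points xi : set X := [set x | (0 < xi [set x])%E].

Definition is_design xi :=
  finite_set (support_points xi) /\ xi (support_points xi) = 1%E.

Section discrimination.
Context (m : nat) (eta : X -> R) (eta2 : X -> 'cV[R]_m -> R).

Definition sq_distance xi (theta : 'cV[R]_m) : \bar R :=
  (\int[xi]_x ((eta x - eta2 x theta) ^+ 2)%:E)%E.

Definition Delta xi : \bar R := ereal_inf (range (sq_distance xi)).

Definition Delta_attained xi := exists theta, sq_distance xi theta = Delta xi.

Definition T_optimal xi :=
  is_design xi /\ forall zeta, is_design zeta -> (Delta zeta <= Delta xi)%E.

End discrimination.

Definition linear_model (m : nat) (f : 'I_m -> X -> R)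
    (x : X) (theta : 'cV[R]_m) : R :=
  (theta^T *m \col_(i < m) f i x) ord0 ord0.

End designs.

(* Main.v *)
From HB Require Import structures.
Require Import Defs.
From mathcomp Require Import all_boot all_order all_algebra.
From mathcomp Require Import all_classical all_reals all_analysis.
From mathcomp Require Import measurable_realfun ring lra.
Import Order.TTheory GRing.Theory Num.Theory.
Import numFieldNormedType.Exports.
Local Open Scope classical_set_scope.
Local Open Scope ring_scope.

(** Every design [xi], optimal or not, can be replaced by a design on at most
    [m + 1] of its own support points whose criterion [Delta] is at least as
    large; applied to a T-optimal design this gives the theorem.

    Let [theta] be a parameter at which the infimum [Delta xi] is attained, let
    [x_i] be the support points, [w_i] their weights and
    [r_i = eta (x_i) - theta^T f (x_i)] the residuals.  Minimality of [theta]
    amounts to the normal equations [\sum_i w_i r_i f (x_i) = 0]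
    ([normal_equations] and its converse [normal_equations_le]).  They are [m]
    linear equations in the weights, so together with the conservation of mass
    they leave a direction [d] in which the weights can move as soon as more
    than [m + 1] of them are nonzero.  As long as the moving weights stay
    nonnegative, the same [theta] remains a minimizer, and therefore [Delta],
    which in general is only concave in the weights, coincides along the segment
    with the linear function [\sum_i w_i r_i ^ 2].  Orient [d] so that this
    function does not decrease, and move until a weight vanishes; then repeat
    ([sparse_weights]).

    The combinatorial core is thus Caratheodory's theorem, with a linear
    objective to be kept from decreasing.  The passage between designs and
    weight vectors is [design_mixture] in one direction and [mixture_exists] in
    the other. *)

(** * Sparse weight vectors with prescribed moments *)

(** A nonzero vector in the left kernel of the rows indexed by [S] exists by
    counting dimensions.  It is extended by zero to the whole index set, which
    keeps the indexing of the weights fixed throughout the reduction. *)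
Lemma row_dependency_on {F : fieldType} {n p : nat} (B : 'M[F]_(n, p))
    (S : {set 'I_n}) :
  (p < #|S|)%N ->
  exists d : 'rV[F]_n,
    [/\ d != 0, d *m B = 0 & forall i, i \notin S -> d 0 i = 0].
Proof.
move=> pS; pose e := @enum_val _ (mem S).
have : kermx (rowsub e B) != 0.
  by rewrite kermx_eq0 /row_free ltn_eqF// (leq_ltn_trans (rank_leq_col _) pS).
case/rowV0Pn => c /sub_kermxP cB c0.
have dE i : (c *m rowsub e 1%:M) 0 i = \sum_j c 0 j * (e j == i)%:R.
  by rewrite mxE; apply: eq_bigr => j _; rewrite !mxE.
exists (c *m rowsub e 1%:M); split.
- have [j cj0] : exists j, c 0 j != 0 by apply/rV0Pn.
  apply/rV0Pn; exists (e j); rewrite dE (bigD1 j)//= eqxx mulr1 big1 ?addr0//.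
  by move=> k kj; rewrite (inj_eq enum_val_inj) (negbTE kj) mulr0.
- by rewrite -mulmxA mul_rowsub_mx mul1mx.
- move=> i iS; rewrite dE big1// => j _.
  by case: eqP => [ji|_]; [rewrite -ji enum_valP in iS | rewrite mulr0].
Qed.

Definition weight_support {R : realFieldType} {n} (w : 'rV[R]_n) : {set 'I_n} :=
  [set i | w 0 i != 0].

(** The move described above: [w + t *: d] with [d] in the left kernel of
    [row_mx V 1] and [t] the largest step that keeps the weights nonnegative.
    Such a [t] is finite because [d] is nonzero with sum zero, hence has a
    negative entry; this is where the additional column of ones, and so the
    additional support point, comes from. *)
Lemma reduce_weight_support {R : realFieldType} {n m : nat} (V : 'M[R]_(n, m))
    (g : 'cV[R]_n) (w : 'rV[R]_n) :
  (forall i, 0 <= w 0 i) -> (m.+1 < #|weight_support w|)%N ->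
  exists w' : 'rV[R]_n,
    [/\ forall i, 0 <= w' 0 i, \sum_i w' 0 i = \sum_i w 0 i,
        w' *m V = w *m V, (w *m g) 0 0 <= (w' *m g) 0 0
      & (#|weight_support w'| < #|weight_support w|)%N].
Proof.
move=> w0 mS.
have [d [dn0 dV dsum dg dS]] : exists d : 'rV[R]_n,
    [/\ d != 0, d *m V = 0, \sum_i d 0 i = 0, 0 <= (d *m g) 0 0
      & forall i, i \notin weight_support w -> d 0 i = 0].
  have : (m + 1 < #|weight_support w|)%N by rewrite addn1.
  case/(row_dependency_on (row_mx V (const_mx 1 : 'cV_n))) => d [dn0 + dS].
  rewrite mul_mx_row => /eqP; rewrite row_mx_eq0 => /andP[/eqP dV /eqP d1].
  have dsum : \sum_i d 0 i = 0.
    have := congr1 (fun A : 'M[R]_1 => A 0 0) d1; rewrite !mxE => d1E.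
    rewrite -[RHS]d1E.
    by apply: eq_bigr => i _; rewrite mxE mulr1.
  (* [d] and [- d] both qualify, except that [g] selects the orientation. *)
  have [dg|/ltW dg] := leP 0 ((d *m g) 0 0); first by exists d.
  exists (- d); split.
  - by rewrite oppr_eq0.
  - by rewrite mulNmx dV oppr0.
  - by under eq_bigr do rewrite mxE; rewrite sumrN dsum oppr0.
  - by rewrite mulNmx mxE oppr_ge0.
  - by move=> i iS; rewrite mxE dS ?oppr0.
have [i1 di1] : exists i, d 0 i < 0.
  apply/existsP; apply: contraNT dn0; rewrite negb_exists => /forallP d0.
  have {}d0 i : 0 <= d 0 i by rewrite leNgt.
  apply/eqP/rowP => i; rewrite mxE.
  by apply: (psumr_eq0P (P := xpredT) (fun j _ => d0 j) dsum).
(* Ratio test: along [d], the weight of index [i0] is the first to vanish. *)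
pose i0 := [arg min_(i < i1 | d 0 i < 0) (w 0 i / - d 0 i)]%O.
have [di0 i0min] : d 0 i0 < 0 /\ forall i, d 0 i < 0 ->
    w 0 i0 / - d 0 i0 <= w 0 i / - d 0 i by rewrite /i0; case: arg_minP.
pose t := w 0 i0 / - d 0 i0.
have t0 : 0 <= t by rewrite divr_ge0// oppr_ge0 ltW.
have w'E i : (w + t *: d) 0 i = w 0 i + t * d 0 i by rewrite !mxE.
have w'i0 : (w + t *: d) 0 i0 = 0.
  by rewrite w'E /t invrN mulrN mulNr divfK ?lt_eqF// subrr.
exists (w + t *: d); split.
- move=> i; rewrite w'E; have [di|di] := leP 0 (d 0 i).
    by rewrite addr_ge0// mulr_ge0.
  rewrite -[t * _]opprK -mulrN subr_ge0 -ler_pdivlMr ?oppr_gt0//.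
  exact: i0min.
- under eq_bigr do rewrite w'E.
  by rewrite big_split -mulr_sumr/= dsum mulr0 addr0.
- by rewrite mulmxDl -scalemxAl dV scaler0 addr0.
- by rewrite mulmxDl -scalemxAl [leRHS]mxE [X in _ + X]mxE lerDl mulr_ge0.
- apply: proper_card; apply/properP; split.
    apply/fintype.subsetP => i; apply: contraLR => iS.
    by rewrite inE w'E dS// mulr0 addr0; rewrite inE in iS.
  exists i0; last by rewrite inE w'i0 eqxx.
  by apply: contraTT di0 => /dS ->; rewrite ltxx.
Qed.

(** Caratheodory's theorem for weight vectors, in the form of linear programming:
    a linear objective on the polytope of nonnegative weights of given mass and
    given [V]-moments is not worse at a suitable basic solution. *)
Lemma sparse_weights {R : realFieldType} {n m : nat} (V : 'M[R]_(n, m))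
    (g : 'cV[R]_n) (w : 'rV[R]_n) :
  (forall i, 0 <= w 0 i) ->
  exists w' : 'rV[R]_n,
    [/\ forall i, 0 <= w' 0 i, \sum_i w' 0 i = \sum_i w 0 i,
        w' *m V = w *m V, (w *m g) 0 0 <= (w' *m g) 0 0
      & (#|weight_support w'| <= m.+1)%N].
Proof.
have [k] := ubnP #|weight_support w|; elim: k w => // k IH w wk w0.
have [|mS] := leqP #|weight_support w| m.+1; first by exists w.
have [w1 [w10 w1s w1V w1g w1S]] := reduce_weight_support V g w w0 mS.
have [w2 [w20 w2s w2V w2g w2S]] := IH w1 (leq_trans w1S wk) w10.
by exists w2; split; rewrite ?w2s ?w2V//; exact: le_trans w2g.
Qed.

(** * Normal equations of weighted least squares *)

Definition residual {R : realType} {X : ptopologicalType} {m : nat}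
    (eta : X -> R) (f : 'I_m -> X -> R) (theta : 'cV[R]_m) (y : X) : R :=
  eta y - linear_model f y theta.

(** Row [i] is the gradient at [theta], up to the factor [- 2], of the squared
    residual at [x i]; thus [w *m residual_moments eta f theta x = 0] are the
    normal equations for the weights [w]. *)
Definition residual_moments {R : realType} {X : ptopologicalType} {n m : nat}
    (eta : X -> R) (f : 'I_m -> X -> R) (theta : 'cV[R]_m) (x : 'I_n -> X) :
    'M[R]_(n, m) :=
  \matrix_(i, j) (residual eta f theta (x i) * f j (x i)).

Lemma linear_modelE {R : realType} {X : ptopologicalType} {m : nat}
    (f : 'I_m -> X -> R) (theta : 'cV[R]_m) (y : X) :
  linear_model f y theta = \sum_j theta j 0 * f j y.
Proof. by rewrite /linear_model mxE; apply: eq_bigr => j _; rewrite !mxE. Qed.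

Lemma residualD {R : realType} {X : ptopologicalType} {m : nat}
    (eta : X -> R) (f : 'I_m -> X -> R) (theta delta : 'cV[R]_m) (y : X) :
  residual eta f (theta + delta) y =
  residual eta f theta y - linear_model f y delta.
Proof.
rewrite /residual !linear_modelE -addrA -opprD; congr (_ - _).
by rewrite -big_split; apply: eq_bigr => j _; rewrite mxE mulrDl.
Qed.

(** The weighted sum of squares is a quadratic polynomial in the parameter; both
    halves of the characterization of its minimizers are read off from this
    expansion. *)
Lemma sum_sq_residualD {R : realType} {X : ptopologicalType} {n m : nat}
    (eta : X -> R) (f : 'I_m -> X -> R) (theta delta : 'cV[R]_m)
    (x : 'I_n -> X) (w : 'rV[R]_n) :
  \sum_i w 0 i * residual eta f (theta + delta) (x i) ^+ 2 =
  \sum_i w 0 i * residual eta f theta (x i) ^+ 2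
  - 2 * (w *m residual_moments eta f theta x *m delta) 0 0
  + \sum_i w 0 i * linear_model f (x i) delta ^+ 2.
Proof.
have -> : (w *m residual_moments eta f theta x *m delta) 0 0 =
    \sum_i w 0 i * (residual eta f theta (x i) * linear_model f (x i) delta).
  rewrite -mulmxA mxE; apply: eq_bigr => i _; rewrite linear_modelE.
  congr (_ * _); rewrite mxE mulr_sumr; apply: eq_bigr => j _.
  by rewrite mxE -mulrA [f j _ * _]mulrC.
rewrite mulr_sumr -sumrN -!big_split; apply: eq_bigr => i _ /=.
rewrite residualD; ring.
Qed.

(** Under the normal equations the linear term of the expansion vanishes, and
    the quadratic term is nonnegative. *)
Lemma normal_equations_le {R : realType} {X : ptopologicalType} {n m : nat}
    (eta : X -> R) (f : 'I_m -> X -> R) (theta : 'cV[R]_m)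
    (x : 'I_n -> X) (w : 'rV[R]_n) :
  (forall i, 0 <= w 0 i) -> w *m residual_moments eta f theta x = 0 ->
  forall theta' : 'cV[R]_m,
    \sum_i w 0 i * residual eta f theta (x i) ^+ 2 <=
    \sum_i w 0 i * residual eta f theta' (x i) ^+ 2.
Proof.
move=> w0 wV theta'; rewrite -[theta'](subrK theta) addrC sum_sq_residualD.
rewrite wV mul0mx mxE mulr0 subr0 lerDl sumr_ge0// => i _.
by rewrite mulr_ge0 ?sqr_ge0.
Qed.

(** Perturbing the [j]-th coordinate of a minimizer by [s] changes the sum of
    squares by [- 2 * (s * b) + s ^+ 2 * c], which is nonnegative for all [s]
    only if [b = 0]; here [b] is the left-hand side of the [j]-th equation and
    [c] the weighted sum of the squares of [f j]. *)
Lemma normal_equations {R : realType} {X : ptopologicalType} {n m : nat}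
    (eta : X -> R) (f : 'I_m -> X -> R) (theta : 'cV[R]_m)
    (x : 'I_n -> X) (w : 'rV[R]_n) :
  (forall i, 0 <= w 0 i) ->
  (forall theta' : 'cV[R]_m,
    \sum_i w 0 i * residual eta f theta (x i) ^+ 2 <=
    \sum_i w 0 i * residual eta f theta' (x i) ^+ 2) ->
  w *m residual_moments eta f theta x = 0.
Proof.
move=> w0 wmin; set V := residual_moments _ _ _ _.
apply/rowP => j; rewrite [RHS]mxE; set b := (w *m V) 0 j.
pose c := \sum_i w 0 i * f j (x i) ^+ 2.
have c0 : 0 <= c by apply: sumr_ge0 => i _; rewrite mulr_ge0 ?sqr_ge0.
have quad s : 0 <= - 2 * (s * b) + s ^+ 2 * c.
  have := wmin (theta + s *: delta_mx j 0); rewrite sum_sq_residualD -subr_ge0.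
  rewrite -scalemxAr -colE mxE [col _ _ _ _]mxE -/b.
  have lmE i : linear_model f (x i) (s *: delta_mx j 0) = s * f j (x i).
    rewrite linear_modelE (bigD1 j)//= !mxE !eqxx mulr1 big1 ?addr0// => k kj.
    by rewrite !mxE (negbTE kj) mulr0 mul0r.
  under [X in _ + X - _]eq_bigr do rewrite lmE exprMn mulrCA.
  rewrite -mulr_sumr -/c; nra.
have c1 : c + 1 != 0 by rewrite gt_eqF// ltr_wpDl.
(* The optimal step is [b / c]; the [+ 1] covers the case [c = 0] as well. *)
have := quad (b / (c + 1)).
have -> : - 2 * (b / (c + 1) * b) + (b / (c + 1)) ^+ 2 * c =
    - (b / (c + 1)) ^+ 2 * (c + 2) by field.
rewrite mulNr oppr_ge0 => bc.
have : (b / (c + 1)) ^+ 2 == 0.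
  by rewrite eq_le sqr_ge0 andbT -(pmulr_lle0 _ (_ : 0 < c + 2))// ltr_wpDl.
by rewrite sqrf_eq0 mulf_eq0 invr_eq0 (negbTE c1) orbF => /eqP.
Qed.

(** * Designs as finite mixtures of Dirac masses *)

(** The points [x i] may repeat and the weights may vanish, so that weights can
    be changed without changing the index set. *)
Definition is_mixture {R : realType} {X : ptopologicalType} {n : nat}
    (xi : probability (design_space X) R) (x : 'I_n -> X) (w : 'rV[R]_n) :=
  (forall i, 0 <= w 0 i) /\
  forall A : set X, xi A = (\sum_i w 0 i * \1_A (x i))%:E.

Lemma design_space_measurable {X : ptopologicalType} (A : set (design_space X)) :
  measurable A.
Proof. exact: sub_sigma_algebra. Qed.

Lemma design_space_measurable_fun {R : realType} {X : ptopologicalType}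
    (g : X -> R) :
  measurable_fun [set: design_space X] (fun x : design_space X => (g x)%:E).
Proof. by move=> _ Y _; exact: design_space_measurable. Qed.

Lemma mixture_sum1 {R : realType} {X : ptopologicalType} {n : nat}
    (xi : probability (design_space X) R) (x : 'I_n -> X) (w : 'rV[R]_n) :
  is_mixture xi x w -> \sum_i w 0 i = 1.
Proof.
move=> [_ xiE]; have := xiE setT; rewrite probability_setT => -[->].
by apply: eq_bigr => i _; rewrite indicT mulr1.
Qed.

Lemma mixture_supported {R : realType} {X : ptopologicalType} {n : nat}
    (xi : probability (design_space X) R) (x : 'I_n -> X) (w : 'rV[R]_n) :
  is_mixture xi x w -> support_points xi `<=` x @` [set` weight_support w].
Proof.
move=> [w0 xiE] y; rewrite /support_points /= xiE lte_fin => xiy.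
apply: contrapT => ny; move: xiy; rewrite big1 ?ltxx// => i _.
have [->|wi] := eqVneq (w 0 i) 0; first by rewrite mul0r.
rewrite indicE memNset ?mulr0// => /= xiy; apply: ny.
by exists i => //=; rewrite inE.
Qed.

Lemma mixture_support_card {R : realType} {X : ptopologicalType} {n : nat}
    (xi : probability (design_space X) R) (x : 'I_n -> X) (w : 'rV[R]_n) :
  is_mixture xi x w -> (support_points xi #<= `I_#|weight_support w|)%card.
Proof.
move=> /mixture_supported xiS; rewrite (card_le_eqr card_II).
apply: card_le_trans (card_image_le (x \o enum_val) _); apply: subset_card_le.
move=> y /xiS[i iS <-]; exists (enum_rank_in iS i) => //=.
by rewrite enum_rankK_in.
Qed.

(** The repetitions allowed among the [x i] are harmless: [xi [set x i]] is at
    least [w 0 i], so every point of nonzero weight is a support point. *)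
Lemma mixture_is_design {R : realType} {X : ptopologicalType} {n : nat}
    (xi : probability (design_space X) R) (x : 'I_n -> X) (w : 'rV[R]_n) :
  is_mixture xi x w -> is_design xi.
Proof.
move=> xiw; split.
  by apply/finite_set_leP; eexists; exact: mixture_support_card xiw.
have [w0 xiE] := xiw; rewrite xiE -(mixture_sum1 _ _ _ xiw); congr EFin.
apply: eq_bigr => i _; have [->|wi] := eqVneq (w 0 i) 0; first by rewrite mul0r.
rewrite indicE mem_set ?mulr1// /support_points /= xiE lte_fin.
rewrite (bigD1 i)//= indicE mem_set// mulr1 ltr_wpDr//.
  by apply: sumr_ge0 => j _; rewrite mulr_ge0.
by rewrite lt_def wi w0.
Qed.

Lemma design_mixture {R : realType} {X : ptopologicalType}
    (xi : probability (design_space X) R) :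
  is_design xi ->
  exists n, exists (x : 'I_n -> X) (w : 'rV[R]_n), is_mixture xi x w.
Proof.
move=> [/finite_seqP[s0 sE0] xi1].
have [s us sE] : exists2 s, uniq s & support_points xi = [set` s].
  exists (undup s0); first exact: undup_uniq.
  by rewrite sE0; apply/seteqP; split => y /=; rewrite mem_undup.
(* The points [x i] are pairwise distinct since [s] has no repetition; the mass
   outside the support is zero, so finite additivity over the singletons of the
   support determines [xi]. *)
pose x i := tnth (in_tuple s) i.
pose w : 'rV[R]_(size s) := \row_i fine (xi [set x i]).
have xi_fin (A : set X) : xi A \is a fin_num.
  by apply: fin_num_measure; exact: design_space_measurable.
exists (size s), x, w; split => [i|A]; first by rewrite mxE fine_ge0.
have ms := @design_space_measurable X.
have sU : A `&` support_points xi = \big[setU/set0]_(i < size s) (A `&` [set x i]).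
  rewrite sE -bigcup_seq; apply/seteqP; split => [y [Ay ys]|y [i _ [Ay /= yi]]].
    have /tnthP[i yi] : y \in in_tuple s by [].
    by exists i; rewrite //= mem_index_enum.
  by rewrite yi in Ay *; split => //; exact: (mem_tnth i (in_tuple s)).
have -> : xi A = xi (A `&` support_points xi).
  have suppC0 : xi (~` support_points xi) = 0%E.
    by rewrite probability_setC// xi1 subee.
  rewrite (measureDI xi (ms A) (ms (support_points xi))) addeC.
  rewrite (@measure_negligible _ _ _ xi (A `\` _)) ?adde0//.
  exists (~` support_points xi); split => // y [] //.
rewrite sU measure_bigsetU_ord//; last first.
  apply/trivIsetP => i j _ _ /eqP ij; apply/seteqP; split => // y.
  move=> [[_ /= ->] [_ /= xij]]; apply: ij; apply/val_inj/eqP.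
  by move: xij; rewrite /x !(tnth_nth y) => /eqP; rewrite nth_uniq.
rewrite -sumEFin; apply: eq_bigr => i _; rewrite mxE.
rewrite indicE; have [xA|xA] := boolP (x i \in A).
  rewrite mulr1 fineK// setIidr// => y ->; exact: set_mem.
rewrite mulr0; suff -> : A `&` [set x i] = set0 by rewrite measure0.
by apply/seteqP; split => // y [] /[swap] -> /mem_set; rewrite (negbTE xA).
Qed.

(** Finite sums of measures are indexed by [nat]: indices from [n] on receive the
    weight [0] and an arbitrary point.  The absolute value provides the
    nonnegativity required of a scaling factor for any [w]. *)
Definition scaled_dirac {R : realType} {X : ptopologicalType} {n : nat}
    (x : 'I_n -> X) (w : 'rV[R]_n) (k : nat) :
    {measure set (design_space X) -> \bar R} :=
  mscale (`|oapp (w 0) 0 (insub k)|%:nng)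
    (dirac (oapp x point (insub k) : design_space X)).

Definition dirac_mixture {R : realType} {X : ptopologicalType} {n : nat}
    (x : 'I_n -> X) (w : 'rV[R]_n) : set (design_space X) -> \bar R :=
  msum (scaled_dirac x w) n.

HB.instance Definition _ (R : realType) (X : ptopologicalType) (n : nat)
    (x : 'I_n -> X) (w : 'rV[R]_n) := Measure.on (dirac_mixture x w).

Lemma dirac_mixtureE {R : realType} {X : ptopologicalType} {n : nat}
    (x : 'I_n -> X) (w : 'rV[R]_n) (A : set X) :
  (forall i, 0 <= w 0 i) ->
  dirac_mixture x w A = (\sum_i w 0 i * \1_A (x i))%:E.
Proof.
move=> w0; rewrite /dirac_mixture/= /msum -sumEFin; apply: eq_bigr => i _.
by rewrite /scaled_dirac/= /mscale/= (valK i)/= ger0_norm// diracE.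
Qed.

Lemma integral_dirac_mixture {R : realType} {X : ptopologicalType} {n : nat}
    (x : 'I_n -> X) (w : 'rV[R]_n) (g : X -> R) :
  (forall i, 0 <= w 0 i) -> (forall y, 0 <= g y) ->
  (\int[dirac_mixture x w]_y (g y)%:E)%E = (\sum_i w 0 i * g (x i))%:E.
Proof.
move=> w0 g0; have mg := @design_space_measurable_fun R X g.
rewrite ge0_integral_measure_sum//; last by move=> y _; rewrite lee_fin.
rewrite -sumEFin; apply: eq_bigr => i _.
rewrite ge0_integral_mscale//; last by move=> y _; rewrite lee_fin.
by rewrite integral_dirac// diracT mul1e (valK i)/= ger0_norm.
Qed.

Lemma mixture_exists {R : realType} {X : ptopologicalType} {n : nat}
    (x : 'I_n -> X) (w : 'rV[R]_n) :
  (forall i, 0 <= w 0 i) -> \sum_i w 0 i = 1 ->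
  exists xi : probability (design_space X) R, is_mixture xi x w.
Proof.
move=> w0 w1.
have mu1 : dirac_mixture x w setT = 1%E.
  by rewrite dirac_mixtureE//; under eq_bigr do rewrite indicT mulr1; rewrite w1.
pose P := Measure_isProbability.Build _ _ _ (dirac_mixture x w) mu1.
pose xi : probability (design_space X) R :=
  HB.pack (dirac_mixture x w) P.
exists xi; split => // A; exact: dirac_mixtureE.
Qed.

Lemma mixture_integral {R : realType} {X : ptopologicalType} {n : nat}
    (xi : probability (design_space X) R) (x : 'I_n -> X) (w : 'rV[R]_n)
    (g : X -> R) :
  is_mixture xi x w -> (forall y, 0 <= g y) ->
  (\int[xi]_y (g y)%:E)%E = (\sum_i w 0 i * g (x i))%:E.
Proof.
move=> [w0 xiE] g0; rewrite -integral_dirac_mixture//.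
apply: eq_measure_integral => A _ _.
exact: etrans (xiE A) (esym (dirac_mixtureE x w A w0)).
Qed.

Lemma mixture_sq_distance {R : realType} {X : ptopologicalType} {n m : nat}
    (xi : probability (design_space X) R) (x : 'I_n -> X) (w : 'rV[R]_n)
    (eta : X -> R) (f : 'I_m -> X -> R) (theta : 'cV[R]_m) :
  is_mixture xi x w ->
  sq_distance eta (linear_model f) xi theta =
  (\sum_i w 0 i * residual eta f theta (x i) ^+ 2)%:E.
Proof.
move=> xiw.
exact: (mixture_integral xi x w (fun y => residual eta f theta y ^+ 2) xiw
  (fun y => sqr_ge0 _)).
Qed.

(** * Reduction of the support of a design *)

(** A parameter minimizing for the weights [w] still satisfies the normal
    equations for the sparse weights [w'], hence minimizes for them too; so both
    values of [Delta] are values of the same linear function of the weights,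
    which is the objective handed to [sparse_weights]. *)
Lemma sparse_design {R : realType} {X : ptopologicalType} {m : nat}
    (eta : X -> R) (f : 'I_m -> X -> R) (xi : probability (design_space X) R) :
  is_design xi -> Delta_attained eta (linear_model f) xi ->
  exists xi' : probability (design_space X) R,
    [/\ is_design xi',
        (Delta eta (linear_model f) xi <= Delta eta (linear_model f) xi')%E
      & (support_points xi' #<= `I_(m.+1))%card].
Proof.
move=> /design_mixture[n [x [w xiw]]] [theta thetaE]; have [w0 _] := xiw.
have wV : w *m residual_moments eta f theta x = 0.
  apply: normal_equations => // theta'; rewrite -lee_fin.
  rewrite -!(mixture_sq_distance _ _ _ eta f _ xiw) thetaE.
  by apply: ereal_inf_lbound; exists theta'.
pose g : 'cV[R]_n := \col_i residual eta f theta (x i) ^+ 2.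
have gE (v : 'rV[R]_n) : (v *m g) 0 0 =
    \sum_i v 0 i * residual eta f theta (x i) ^+ 2.
  by rewrite mxE; apply: eq_bigr => i _; rewrite mxE.
have [w' [w'0 w's w'V w'g w'S]] :=
  sparse_weights (residual_moments eta f theta x) g w w0.
rewrite (mixture_sum1 _ _ _ xiw) in w's; rewrite wV in w'V.
have [xi' xi'w] := mixture_exists x w' w'0 w's.
exists xi'; split; first exact: mixture_is_design xi'w.
- rewrite -thetaE (mixture_sq_distance _ _ _ _ _ _ xiw).
  apply: le_ereal_inf_tmp => _ [theta' _ <-].
  rewrite (mixture_sq_distance _ _ _ _ _ _ xi'w) lee_fin.
  apply: (le_trans (y := (w' *m g) 0 0)); first by rewrite -gE.
  by rewrite gE; exact: normal_equations_le.
- apply: card_le_trans (mixture_support_card _ _ _ xi'w) _.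
  by rewrite card_le_II.
Qed.

Theorem corollary3p2 (R : realType) (X : ptopologicalType) (m2 : nat)
    (eta : X -> R) (f : 'I_m2 -> X -> R) :
  continuous eta ->
  (forall i : 'I_m2, continuous (f i)) ->
  (forall xi : probability (design_space X) R,
     is_design xi -> Delta_attained eta (linear_model f) xi) ->
  (exists xi : probability (design_space X) R,
     T_optimal eta (linear_model f) xi) ->
  exists xi : probability (design_space X) R,
    T_optimal eta (linear_model f) xi /\
    (support_points xi #<= `I_(m2.+1))%card.
Proof.
move=> _ _ attained [xi [xi_design xi_opt]].
have [xi' [xi'_design xi'_ge xi'_card]] :=
  sparse_design eta f xi xi_design (attained xi xi_design).
exists xi'; split => //; split => // zeta /xi_opt zeta_le.
exact: le_trans zeta_le xi'_ge.
Qed.
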